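(* Let $\kappa$ be a regular uncountable cardinal. Then $\mathrm{IP}(\kappa,\kappa)$ implies $\mathrm{HP}(\kappa)$.
   Context: Notation. For a set $X$ and $n\in\omega$, $((X))^n$ is the set of injective $n$-tuples of elements of $X$, and $((X))^{<\omega}=\bigcup_{n<\omega}((X))^n$. For sets $X_0,\dots,X_{n-1}$, $((X_0,\dots,X_{n-1}))$ is the set of injective tuples in $X_0\times\cdots\times X_{n-1}$. $f''S$ is the image of $S$ under $f$. $\mathcal H(\aleph_1)$ is the set of hereditarily countable sets. A set $A\subseteq\mathcal H(\aleph_1)$ is definable if there are a formula $\varphi$ of the language of set theory and $a\in\mathcal H(\aleph_1)$ with $A=\{x\in\mathcal H(\aleph_1):\langle\mathcal H(\aleph_1),\in\rangle\models\varphi(x,a)\}$; a function is definable if its graph is. $\mathrm{IP}(\kappa,\lambda)$ (for cardinals $\lambda\le\kappa$): for any $f:\kappa\to\mathcal P(\omega)$ and any definable $g:((\mathcal P(\omega)))^{<\omega}\to\mathcal P(\omega)$, at least one of the following holds: (i0) there is a stationary $S\subseteq\kappa$ such that $|g''((f''S))^n|<\lambda$ for every $n\in\omega$; (i1) there are $k\in\omega\setminus\{0\}$ and stationary $S_0,\dots,S_{k-1}\subseteq\kappa$ such that for any $\langle x_0,\dots,x_{k-1}\rangle,\langle y_0,\dots,y_{k-1}\rangle\in((f''S_0,\dots,f''S_{k-1}))$, if $x_n\ne y_n$ for all $n<k$ then $g(x_0,\dots,x_{k-1})\neq g(y_0,\dots,y_{k-1})$. $\mathrm{HP}(\kappa)$: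 for any $f:\kappa\to\mathcal P(\omega)$ and any definable $A\subseteq((\mathcal P(\omega)))^{<\omega}$, at least one of the following holds: (h0) there is a stationary $S\subseteq\kappa$ such that $((f''S))^{<\omega}\setminus\{\emptyset\}\subseteq A$; (h1) there are $k\in\omega\setminus\{0\}$ and stationary $S_0,\dots,S_{k-1}\subseteq\kappa$ such that $((f''S_0,\dots,f''S_{k-1}))\cap A=\emptyset$. *)

(* Defs.v *)
From HB Require Import structures.
From mathcomp Require Import all_boot all_order.
From mathcomp Require Import boolp classical_sets functions cardinality wochoice.

Set Implicit Arguments.
Unset Strict Implicit.
Unset Printing Implicit Defensive.

Local Open Scope classical_set_scope.
Local Open Scope order_scope.
Local Open Scope card_scope.

(* ((X_0, ..., X_{n-1})) *)
Definition inj_prod (T : choiceType) (n : nat) (X : 'I_n -> set T) :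
    set (n.-tuple T) :=
  [set t : n.-tuple T | uniq t /\ forall i, X i (tnth t i)].

(* ((X))^n *)
Definition inj_pow (T : choiceType) (X : set T) (n : nat) : set (n.-tuple T) :=
  inj_prod (fun _ : 'I_n => X).
Arguments inj_pow {T} X n.

(* ((X))^{<omega}: tuples of all finite lengths are collected in [seq T] *)
Definition inj_fin (T : choiceType) (X : set T) : set (seq T) :=
  \bigcup_n [set tval t | t in inj_pow X n].

(* A hereditarily countable set is a countable set of hereditarily countable
   sets.  As in Aczel's interpretation of set theory, [HC_sup F] stands for the
   set {a | F i = Some a for some i}, which ranges over all countable sets of
   such objects ([None] accounts for the empty set).  A set has many such
   presentations, so equality of sets is the bisimulation [hc_eq], and
   H(aleph_1) is [HC] modulo [hc_eq]. *)
Inductive HC : Type := HC_sup (F : nat -> option HC).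

Fixpoint hc_eq (x y : HC) : Prop :=
  match x, y with
  | HC_sup F, HC_sup G =>
      (forall i, if F i is Some a then
         exists j, if G j is Some b then hc_eq a b else False else True) /\
      (forall j, if G j is Some b then
         exists i, if F i is Some a then hc_eq a b else False else True)
  end.

Definition hc_mem (x y : HC) : Prop :=
  let: HC_sup G := y in exists j b, G j = Some b /\ hc_eq x b.

(* von Neumann successor x U {x} and natural numbers *)
Definition hc_succ (x : HC) : HC :=
  let: HC_sup F := x in HC_sup (fun i => if i is j.+1 then F j else Some x).

Definition hc_nat (n : nat) : HC := iter n hc_succ (HC_sup (fun=> None)).

Definition hc_real (X : set nat) : HC :=
  HC_sup (fun n => if n \in X then Some (hc_nat n) else None).

(* {x, y} and the Kuratowski pair <x, y> = {{x}, {x, y}} *)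
Definition hc_upair (x y : HC) : HC :=
  HC_sup (fun i => Some (if i is 0%N then x else y)).

Definition hc_pair (x y : HC) : HC := hc_upair (hc_upair x x) (hc_upair x y).

(* a tuple s of subsets of omega, as the function {<i, s_i> | i < size s} *)
Definition hc_tuple (s : seq (set nat)) : HC :=
  HC_sup (fun i => omap (fun X => hc_pair (hc_nat i) (hc_real X)) (onth s i)).

(* Formulas of the language of set theory, with de Bruijn variables. *)
Inductive formula : Type :=
| Mem (i j : nat)
| Eq (i j : nat)
| Neg (phi : formula)
| And (phi psi : formula)
| Ex (phi : formula).

Definition env_cons (x : HC) (e : nat -> HC) (i : nat) : HC :=
  if i is j.+1 then e j else x.

Fixpoint sat (e : nat -> HC) (phi : formula) : Prop :=
  match phi with
  | Mem i j => hc_mem (e i) (e j)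
  | Eq i j => hc_eq (e i) (e j)
  | Neg phi => ~ sat e phi
  | And phi psi => sat e phi /\ sat e psi
  | Ex phi => exists x, sat (env_cons x e) phi
  end.

(* In phi(x, a), variable 0 is x; all other free variables denote a, so that
   phi really has only the two arguments x and a. *)
Definition definable (A : set HC) : Prop :=
  exists (phi : formula) (a : HC),
    forall x, A x <-> sat (env_cons x (fun=> a)) phi.

Definition definable_tuples (A : set (seq (set nat))) : Prop :=
  definable [set x | exists2 s, A s & hc_eq x (hc_tuple s)].

(* [g] is considered as a function with domain [D] only: its values outside
   [D] do not matter. *)
Definition definable_fun (D : set (seq (set nat))) (g : seq (set nat) -> set nat) :
    Prop :=
  definable
    [set x | exists2 s, D s & hc_eq x (hc_pair (hc_tuple s) (hc_real (g s)))].

Definition card_lt (T U : Type) (A : set T) (B : set U) : Prop :=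
  (A #<= B) /\ ~ (B #<= A).

Section Cardinal.
Context {d : Order.disp_t} (K : orderType d).

Definition unbounded (A : set K) : Prop :=
  forall b : K, exists2 a, A a & b <= a.

(* The order type of K is an initial ordinal, i.e. a cardinal. *)
Definition is_cardinal : Prop :=
  well_order (<=%O : rel K) /\
  forall a : K, card_lt [set x : K | x < a] [set: K].

Definition regular_uncountable : Prop :=
  [/\ is_cardinal,
      ~ countable [set: K] &
      forall A : set K, unbounded A -> ~ card_lt A [set: K]].

(* C contains every nonzero e < kappa in which it is unbounded; such an e is
   automatically a limit, since the elements c are strictly between b and e. *)
Definition closed_subset (C : set K) : Prop :=
  forall e : K, (exists b, b < e) ->
    (forall b, b < e -> exists2 c, C c & b < c < e) -> C e.

Definition club (C : set K) : Prop := closed_subset C /\ unbounded C.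

Definition stationary (S : set K) : Prop :=
  forall C, club C -> S `&` C !=set0.

(* A cardinal lambda <= kappa is given by a subset L of K of cardinality
   lambda; IP(kappa, kappa) is [IP [set: K]]. *)
Definition IP (L : set K) : Prop :=
  forall (f : K -> set nat) (g : seq (set nat) -> set nat),
    definable_fun (inj_fin [set: set nat]) g ->
    (exists2 S : set K, stationary S &
       forall n : nat, card_lt [set g (tval t) | t in inj_pow (f @` S) n] L)
    \/
    (exists (k : nat) (S : 'I_k -> set K),
       [/\ k <> 0%N,
           forall i, stationary (S i) &
           forall x y : k.-tuple (set nat),
             inj_prod (fun i => f @` S i) x ->
             inj_prod (fun i => f @` S i) y ->
             (forall i, tnth x i <> tnth y i) -> g x <> g y]).

Definition HP : Prop :=
  forall (f : K -> set nat) (A : set (seq (set nat))),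
    A `<=` inj_fin [set: set nat] -> definable_tuples A ->
    (exists2 S : set K, stationary S &
       inj_fin (f @` S) `\ [::] `<=` A)
    \/
    (exists (k : nat) (S : 'I_k -> set K),
       [/\ k <> 0%N,
           forall i, stationary (S i) &
           [set tval t | t in inj_prod (fun i => f @` S i)] `&` A = set0]).

End Cardinal.

(* Main.v *)
Require Import Defs.
From mathcomp Require Import all_boot all_order.
From mathcomp Require Import boolp classical_sets functions cardinality wochoice.

Set Implicit Arguments.
Unset Strict Implicit.
Unset Printing Implicit Defensive.

Import Order.TTheory.

Local Open Scope classical_set_scope.

(** Apply IP to the following function g: it is empty on the tuples that belong
    to A and on the empty tuple, and it maps any other tuple to its first entry
    ([guarded_head]).

    If some fibre of f is stationary, its image is a single real r, and whether
    <r> belongs to A decides between (h0) and (h1).  Otherwise every fibre is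
    nonstationary, and since the nonstationary ideal is kappa-complete
    ([stationary_setD_bigcup]), so is the preimage under f of any set of fewer
    than kappa reals: such a preimage can be removed from stationary sets.

    In case (i0), g takes fewer than kappa values on the n-tuples from f''S, for
    every n.  Remove from S the points that f maps to such a value, for some n.
    A nonempty tuple outside A from the image of what is left would have its
    first entry, which is its value under g, among the removed reals.

    In case (i1), suppose that some x in A belongs to the product of the f''S_i,
    and remove from the S_i the points that f maps to an entry of x.  Any tuple y
    in A from the new product would differ from x in every coordinate although
    g(x) = g(y), both values being empty.  So the new product misses A.

    That g is definable, with a parameter coding omega and the parameter for A, is
    checked in the coded version of H(aleph_1).  The point there is that the codes
    of injective tuples of reals are described by a formula
    ([graph_of_inj_tupleP]). *)

(** * The nonstationary ideal *)

Lemma card_lt_image (T U V : Type) (h : T -> U) (A : set T) (B : set V) :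
  card_lt A B -> card_lt (h @` A) B.
Proof.
move=> [AB nBA]; split; first exact: card_le_trans (card_image_le h A) AB.
by move=> Bh; apply: nBA; apply: card_le_trans Bh (card_image_le h A).
Qed.

Lemma card_lt_countable (T U : Type) (A : set T) (B : set U) :
  countable A -> ~ countable B -> card_lt A B.
Proof.
move=> cA ncB; split; last by move=> BA; apply: ncB; apply: card_le_trans BA cA.
apply: card_le_trans cA _; apply/infiniteP => /finite_set_countable.
exact: ncB.
Qed.

Lemma regular_small_bounded (d : Order.disp_t) (K : orderType d) (A : set K) :
    regular_uncountable K -> card_lt A [set: K] ->
  exists b, forall a, A a -> (a < b)%O.
Proof.
move=> [_ _ reg] smallA; apply: contrapT => nb; apply: (reg A) => // b.
apply: contrapT => nA; apply: nb; exists b => a Aa.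
by rewrite ltNge; apply/negP => ba; apply: nA; exists a.
Qed.

Lemma cardinal_least (d : Order.disp_t) (K : orderType d) (P : K -> Prop) (x : K) :
    is_cardinal K -> P x ->
  exists2 m, P m & forall y, P y -> (m <= y)%O.
Proof.
move=> [wo _] Px.
have [|m [[Pm minm] _]] := wo [pred y | `[< P y >]].
  by exists x; rewrite inE.
exists m; first by move: Pm; rewrite inE.
by move=> y Py; apply: minm; rewrite inE.
Qed.

(** Iterating countably often a function that jumps over an element of each
    [C i], one reaches a supremum in which every [C i] is unbounded. *)
Lemma club_bigcap (d : Order.disp_t) (K : orderType d) (I : Type) (D : set I)
    (C : I -> set K) :
    regular_uncountable K -> card_lt D [set: K] ->
    (forall i, D i -> club (C i)) ->
  club (\bigcap_(i in D) C i).
Proof.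
move=> hK smallD clubC; have [cK ncK _] := hK.
have above (x : K) : exists y, (x < y)%O.
  have [|y xy] := @regular_small_bounded _ K [set x] hK.
    exact: card_lt_countable (countable1 x) ncK.
  by exists y; apply: xy.
split=> [e lim_e elim i Di | b].
  have [closedC _] := clubC i Di; apply: closedC => // x /elim[c capc xce].
  by exists c => //; apply: capc.
(* Regularity bounds the chosen elements of the [C i] above [x] by one [y]. *)
have jump (x : K) : exists y,
    (x < y)%O /\ forall i, D i -> exists2 c, C i c & (x < c < y)%O.
  have [x' xx'] := above x.
  have /choice[c cP] (i : I) : exists c, D i -> C i c /\ (x < c)%O.
    have [Di|nDi] := pselect (D i); last by exists x.
    have [_ unbC] := clubC i Di; have [c Cc x'c] := unbC x'.
    by exists c => _; split=> //; apply: lt_le_trans xx' x'c.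
  have [u cu] := regular_small_bounded hK (card_lt_image c smallD).
  exists (Order.max x' u); split=> [|i Di]; first by rewrite lt_max xx'.
  have [Cc xc] := cP i Di; exists (c i) => //; rewrite xc lt_max.
  by rewrite (cu (c i)) ?orbT //; exists i.
have [nx nxP] := choice jump.
pose orb n := iter n nx b.
(* The orbit of [b] is bounded because kappa has uncountable cofinality. *)
have [u orb_u] : exists u, forall n, (orb n < u)%O.
  have [|u orb_u] := @regular_small_bounded _ K (orb @` setT) hK.
    by apply/card_lt_image/card_lt_countable.
  by exists u => n; apply: orb_u; exists n.
pose above_orb u := forall n, (orb n < u)%O.
have [e orb_e min_e] := cardinal_least (P := above_orb) cK orb_u.
exists e; last exact: ltW (orb_e 0%N).
move=> i Di; have [closedC _] := clubC i Di.
apply: closedC; first by exists b; apply: (orb_e 0%N).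
move=> x xe.
have [n xn] : exists n, (x <= orb n)%O.
  apply: contrapT => nx_orb; move: xe; rewrite ltNge => /negP; apply.
  apply: min_e => n; rewrite ltNge; apply/negP => xn.
  by apply: nx_orb; exists n.
have [_ /(_ i Di)[c Cc /andP[nc cn]]] := nxP (orb n).
exists c => //; rewrite (le_lt_trans xn nc) /=.
exact: lt_trans cn (orb_e n.+1).
Qed.

(** The nonstationary ideal is kappa-complete: if clubs witness that the [N i] are
    nonstationary, their intersection, which is a club, avoids every [N i]. *)
Lemma stationary_setD_bigcup (d : Order.disp_t) (K : orderType d) (I : Type)
    (D : set I) (N : I -> set K) (S : set K) :
    regular_uncountable K -> card_lt D [set: K] ->
    (forall i, D i -> ~ stationary (N i)) ->
  stationary S -> stationary (S `\` \bigcup_(i in D) N i).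
Proof.
move=> hK smallD nonstat statS E clubE; have [_ ncK _] := hK.
have /choice[C CP] (i : I) :
    exists C, D i -> club C /\ forall x, N i x -> ~ C x.
  have [Di|nDi] := pselect (D i); last by exists setT.
  apply: contrapT => nC; apply: (nonstat i Di) => C clubC; apply: contrapT => NC.
  by apply: nC; exists C => _; split=> // x Nx Cx; apply: NC; exists x.
have clubcap : club (\bigcap_(i in D) C i).
  by apply: club_bigcap => // i Di; have [] := CP i Di.
have clubcapE : club (E `&` \bigcap_(i in D) C i).
  rewrite -bigcap2E; apply: club_bigcap => //; first exact: card_lt_countable.
  move=> [|[|n]] _ //=; split=> [//|b]; last by exists b.
have [x [Sx [Ex capx]]] := statS _ clubcapE.
exists x; split=> //; split=> // -[i Di Nx].
by have [_ /(_ x Nx)] := CP i Di; apply; apply: capx.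
Qed.

Lemma stationary_nonempty (d : Order.disp_t) (K : orderType d) (S : set K) :
  stationary S -> S !=set0.
Proof.
move=> /(_ setT)[|x [Sx _]]; last by exists x.
by split=> // b; exists b.
Qed.

Lemma stationary_setD_preimage (d : Order.disp_t) (K : orderType d) (T : Type)
    (f : K -> T) (G : set T) (S : set K) :
    regular_uncountable K -> (forall r, ~ stationary (f @^-1` [set r])) ->
    card_lt G [set: K] ->
  stationary S -> stationary (S `\` f @^-1` G).
Proof.
move=> hK fibres smallG statS.
suff -> : f @^-1` G = \bigcup_(r in G) f @^-1` [set r].
  by apply: stationary_setD_bigcup.
rewrite -preimage_bigcup; congr (f @^-1` _).
by apply/seteqP; split=> [r Gr|r [? ? ->]//]; exists r.
Qed.

Lemma nonstationary_preimage (d : Order.disp_t) (K : orderType d) (T : Type)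
    (f : K -> T) (G : set T) :
    regular_uncountable K -> (forall r, ~ stationary (f @^-1` [set r])) ->
    card_lt G [set: K] ->
  ~ stationary (f @^-1` G).
Proof.
move=> hK fibres smallG /(stationary_setD_preimage hK fibres smallG).
by rewrite setDv => /stationary_nonempty[].
Qed.

(** * Hereditarily countable sets up to bisimulation *)

(** The induction principle generated for [HC] gives no hypothesis about the
    members, because they occur below [option]. *)
Lemma HC_nested_ind (P : HC -> Prop) :
    (forall F, (forall i a, F i = Some a -> P a) -> P (HC_sup F)) ->
  forall x, P x.
Proof.
move=> PF; fix IH 1 => -[F]; apply: PF => i a.
case: (F i) => [b|]; last by discriminate.
by move=> [<-]; apply: IH.
Qed.

Lemma hc_eq_sup (F G : nat -> option HC) :
  hc_eq (HC_sup F) (HC_sup G) <->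
  (forall i a, F i = Some a -> exists j b, G j = Some b /\ hc_eq a b) /\
  (forall j b, G j = Some b -> exists i a, F i = Some a /\ hc_eq a b).
Proof.
split=> -[FG GF]; split.
- move=> i a Fi; have := FG i; rewrite Fi => -[j].
  by case Gj: (G j) => [b|//]; exists j, b.
- move=> j b Gj; have := GF j; rewrite Gj => -[i].
  by case Fi: (F i) => [a|//]; exists i, a.
- move=> i; case Fi: (F i) => [a|//]; have [j [b [Gj ab]]] := FG i a Fi.
  by exists j; rewrite Gj.
- move=> j; case Gj: (G j) => [b|//]; have [i [a [Fi ab]]] := GF j b Gj.
  by exists i; rewrite Fi.
Qed.

Lemma hc_eq_refl x : hc_eq x x.
Proof.
elim/HC_nested_ind: x => F IH; apply/hc_eq_sup.
by split=> i a Fi; exists i, a; split=> //; apply: (IH i).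
Qed.

Lemma hc_eq_sym x y : hc_eq x y -> hc_eq y x.
Proof.
elim/HC_nested_ind: x y => F IH [G] /hc_eq_sup[FG GF]; apply/hc_eq_sup; split.
- by move=> j b /GF[i [a [Fi ab]]]; exists i, a; split=> //; apply: (IH i).
- move=> i a Fi; have [j [b [Gj ab]]] := FG i a Fi.
  by exists j, b; split=> //; apply: (IH i).
Qed.

Lemma hc_eq_trans y x z : hc_eq x y -> hc_eq y z -> hc_eq x z.
Proof.
elim/HC_nested_ind: x y z => F IH [G] [H] /hc_eq_sup[FG GF] /hc_eq_sup[GH HG].
apply/hc_eq_sup; split.
- move=> i a Fi; have [j [b [Gj ab]]] := FG i a Fi.
  have [k [c [Hk bc]]] := GH j b Gj; exists k, c; split=> //; exact: (IH i a Fi b).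
- move=> k c Hk; have [j [b [Gj bc]]] := HG k c Hk.
  have [i [a [Fi ab]]] := GF j b Gj; exists i, a; split=> //; exact: (IH i a Fi b).
Qed.

Lemma hc_mem_congr x x' y y' :
  hc_eq x x' -> hc_eq y y' -> hc_mem x y -> hc_mem x' y'.
Proof.
case: y y' => [G] [G'] xx' /hc_eq_sup[GG' _] [j [b [Gj xb]]].
have [k [c [Gk bc]]] := GG' j b Gj; exists k, c; split=> //.
exact: hc_eq_trans (hc_eq_sym xx') (hc_eq_trans xb bc).
Qed.

Lemma hc_mem_eq z x y : hc_eq x y -> hc_mem z x <-> hc_mem z y.
Proof.
move=> xy; split; apply: hc_mem_congr => //; try exact: hc_eq_refl.
exact: hc_eq_sym.
Qed.

Lemma hc_ext x y : (forall z, hc_mem z x <-> hc_mem z y) -> hc_eq x y.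
Proof.
case: x y => [F] [G] FG; apply/hc_eq_sup; split=> [i a Fi|j b Gj].
- have /FG[j [b [Gj ab]]] : hc_mem a (HC_sup F).
    by exists i, a; split=> //; apply: hc_eq_refl.
  by exists j, b.
- have /FG[i [a [Fi ba]]] : hc_mem b (HC_sup G).
    by exists j, b; split=> //; apply: hc_eq_refl.
  by exists i, a; split=> //; apply: hc_eq_sym.
Qed.

Lemma hc_mem_upair z x y : hc_mem z (hc_upair x y) <-> hc_eq z x \/ hc_eq z y.
Proof.
split=> [[[|i] [b [[<-] zb]]]|[zx|zy]]; [by left|by right| |].
- by exists 0%N, x.
- by exists 1%N, y.
Qed.

Lemma hc_eq_upair z x y :
  hc_eq z (hc_upair x y) <-> forall t, hc_mem t z <-> hc_eq t x \/ hc_eq t y.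
Proof.
split=> [zxy t|zxy]; first by rewrite (hc_mem_eq t zxy) hc_mem_upair.
by apply: hc_ext => t; rewrite zxy hc_mem_upair.
Qed.

Lemma hc_eq_upair2 x y x' y' :
  hc_eq (hc_upair x y) (hc_upair x' y') ->
  (hc_eq x x' /\ hc_eq y y') \/ (hc_eq x y' /\ hc_eq y x').
Proof.
move=> e.
have mem t : hc_eq t x \/ hc_eq t y <-> hc_eq t x' \/ hc_eq t y'.
  by rewrite -!hc_mem_upair; apply: hc_mem_eq.
have tr := hc_eq_trans; have sy := hc_eq_sym; have re := hc_eq_refl.
have [xx'|xy'] : hc_eq x x' \/ hc_eq x y' by apply/mem; left.
- have [yx'|] : hc_eq y x' \/ hc_eq y y' by apply/mem; right.
    have [y'x|y'y] : hc_eq y' x \/ hc_eq y' y by apply/mem; right.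
    + by left; split=> //; apply: tr yx' (tr _ _ _ (sy _ _ xx') (sy _ _ y'x)).
    + by left; split=> //; apply: sy.
  by left.
- have [|yy'] : hc_eq y x' \/ hc_eq y y' by apply/mem; right.
    by right.
  have [x'x|x'y] : hc_eq x' x \/ hc_eq x' y by apply/mem; left.
  + by left; split=> //; apply: sy.
  + by right; split=> //; apply: sy.
Qed.

Lemma hc_upair_congr x y x' y' :
  hc_eq x x' -> hc_eq y y' -> hc_eq (hc_upair x y) (hc_upair x' y').
Proof.
move=> xx' yy'; apply/hc_eq_sup; split=> -[|i] a [<-]; 
  by [exists 0%N, x'|exists 1%N, y'|exists 0%N, x|exists 1%N, y].
Qed.

Lemma hc_eq_pair x y x' y' :
  hc_eq (hc_pair x y) (hc_pair x' y') <-> hc_eq x x' /\ hc_eq y y'.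
Proof.
split=> [|[xx' yy']]; last by do !apply: hc_upair_congr.
have tr := hc_eq_trans; have sy := hc_eq_sym.
case/hc_eq_upair2 => -[/hc_eq_upair2 e1 /hc_eq_upair2 e2];
  move: e1 e2 => [[]|[]] ? ? [[]|[]] ? ?; split; eauto 6.
Qed.

Lemma hc_mem_nat z n :
  hc_mem z (hc_nat n) <-> exists2 m, (m < n)%N & hc_eq z (hc_nat m).
Proof.
elim: n => [|n IH]; first by split=> [[j [b []]]|[]].
have -> : hc_mem z (hc_nat n.+1) <-> hc_eq z (hc_nat n) \/ hc_mem z (hc_nat n).
  rewrite /hc_nat iterS -/(hc_nat n); case: (hc_nat n) => F /=; split.
  - by move=> [[|j] [b [Fj zb]]]; [left; case: Fj => ->|right; exists j, b].
  - by move=> [zF|[j [b Fj]]]; [exists 0%N; eexists; split|exists j.+1, b].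
rewrite IH; split=> [[zn|[m mn zm]]|[m mn zm]].
- by exists n.
- by exists m => //; apply: ltnW.
- move: mn zm; rewrite ltnS leq_eqVlt => /orP[/eqP-> zn|mn zm]; first by left.
  by right; exists m.
Qed.

(** If [hc_nat m] equals [hc_nat n] with [m < n], it is a member of itself, so it
    equals some [hc_nat m'] with [m' < m]: this descent is impossible. *)
Lemma hc_nat_inj m n : hc_eq (hc_nat m) (hc_nat n) -> m = n.
Proof.
have self k k' : (k < k')%N -> hc_eq (hc_nat k) (hc_nat k') ->
    exists2 l, (l < k)%N & hc_eq (hc_nat l) (hc_nat k).
  move=> kk' /[dup] e /(hc_mem_eq (hc_nat k)).
  rewrite !hc_mem_nat => -[_ []]; first by exists k => //; apply: hc_eq_refl.
  by move=> l lk kl; exists l => //; apply: hc_eq_sym.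
have lt_neq k : forall k', (k < k')%N -> ~ hc_eq (hc_nat k) (hc_nat k').
  by elim/ltn_ind: k => k IH k' /self s /s[l lk]; apply: IH.
move=> mn; case: (ltngtP m n) => // [lt|lt]; first by case: (lt_neq _ _ lt).
by case: (lt_neq _ _ lt); apply: hc_eq_sym.
Qed.

Lemma hc_mem_real z X :
  hc_mem z (hc_real X) <-> exists2 m, X m & hc_eq z (hc_nat m).
Proof.
split=> [[m [b []]]|[m Xm zm]].
- by case: ifPn => //; rewrite in_setE => Xm [<-] zm; exists m.
- by exists m, (hc_nat m); rewrite mem_set.
Qed.

Lemma hc_mem_nat_real n X : hc_mem (hc_nat n) (hc_real X) <-> X n.
Proof.
rewrite hc_mem_real; split=> [[m Xm /hc_nat_inj->]//|Xn].
by exists n => //; apply: hc_eq_refl.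
Qed.

Lemma hc_real_inj X Y : hc_eq (hc_real X) (hc_real Y) -> X = Y.
Proof.
move=> XY; apply/seteqP; split=> n.
- by rewrite -!hc_mem_nat_real (hc_mem_eq _ XY).
- by rewrite -!hc_mem_nat_real (hc_mem_eq _ XY).
Qed.

Lemma hc_mem_tuple z s :
  hc_mem z (hc_tuple s) <->
  exists2 i, (i < size s)%N &
    hc_eq z (hc_pair (hc_nat i) (hc_real (nth set0 s i))).
Proof.
split=> [[i [b []]]|[i ltis zi]].
- case: (ltnP i (size s)) => [ltis|ges]; last by rewrite onth_default.
  by rewrite onthE (nth_map set0) //= => -[<-] zi; exists i.
- by exists i; eexists; split; last exact: zi; rewrite onthE (nth_map set0).
Qed.

Lemma hc_mem_pair_tuple x y s :
  hc_mem (hc_pair x y) (hc_tuple s) <->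
  exists2 i, (i < size s)%N &
    hc_eq x (hc_nat i) /\ hc_eq y (hc_real (nth set0 s i)).
Proof.
rewrite hc_mem_tuple.
by split=> -[i ltis /hc_eq_pair xy]; exists i.
Qed.

Lemma hc_tuple_inj s t : hc_eq (hc_tuple s) (hc_tuple t) -> s = t.
Proof.
have sub u v : hc_eq (hc_tuple u) (hc_tuple v) -> forall i, (i < size u)%N ->
    (i < size v)%N /\ nth set0 u i = nth set0 v i.
  move=> uv i iu.
  have : hc_mem (hc_pair (hc_nat i) (hc_real (nth set0 u i))) (hc_tuple u).
    by apply/hc_mem_tuple; exists i => //; apply: hc_eq_refl.
  by move/(hc_mem_eq _ uv)/hc_mem_pair_tuple => [j jv [/hc_nat_inj-> /hc_real_inj->]].
move=> st; have ts := hc_eq_sym st.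
have le u v : hc_eq (hc_tuple u) (hc_tuple v) -> (size u <= size v)%N.
  by move=> uv; rewrite leqNgt; apply/negP => /(sub _ _ uv)[]; rewrite ltnn.
apply: (@eq_from_nth _ set0) => [|i /(sub _ _ st)[]//].
by apply/eqP; rewrite eqn_leq !le.
Qed.

(** * Definable relations *)

(** Stating expressibility for predicates of the whole environment lets formulas be
    found by following the shape of the predicate: the closure properties below
    apply syntactically, also under binders, where a quantifier only shifts the
    environment, and no de Bruijn term is ever written. *)
Definition expressible (P : (nat -> HC) -> Prop) : Prop :=
  exists phi, forall e, P e <-> sat e phi.

Lemma expressible_ext P Q :
  (forall e, P e <-> Q e) -> expressible Q -> expressible P.
Proof. by move=> PQ [phi Qphi]; exists phi => e; rewrite PQ. Qed.

Lemma expressible_mem i j : expressible (fun e => hc_mem (e i) (e j)).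
Proof. by exists (Defs.Mem i j). Qed.

Lemma expressible_eq i j : expressible (fun e => hc_eq (e i) (e j)).
Proof. by exists (Defs.Eq i j). Qed.

Lemma expressible_not P : expressible P -> expressible (fun e => ~ P e).
Proof. by move=> [phi Pphi]; exists (Neg phi) => e /=; rewrite Pphi. Qed.

Lemma expressible_and P Q :
  expressible P -> expressible Q -> expressible (fun e => P e /\ Q e).
Proof.
by move=> [phi Pphi] [psi Qpsi]; exists (And phi psi) => e /=; rewrite Pphi Qpsi.
Qed.

Lemma expressible_ex (Q : HC -> (nat -> HC) -> Prop) :
  expressible (fun e => Q (e 0%N) (fun i => e i.+1)) ->
  expressible (fun e => exists x, Q x e).
Proof.
move=> [phi Qphi]; exists (Ex phi) => e /=.
by split=> -[x Qx]; exists x; [rewrite -Qphi|move: Qx; rewrite -Qphi].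
Qed.

Lemma expressible_imp P Q :
  expressible P -> expressible Q -> expressible (fun e => P e -> Q e).
Proof.
move=> hP hQ; apply: (@expressible_ext _ (fun e => ~ (P e /\ ~ Q e))).
  by move=> e; split=> [PQ [/PQ]//|nPQ Pe]; apply: contrapT => nQ; apply: nPQ.
by apply/expressible_not/expressible_and => //; apply: expressible_not.
Qed.

Lemma expressible_or P Q :
  expressible P -> expressible Q -> expressible (fun e => P e \/ Q e).
Proof.
move=> hP hQ; apply: (@expressible_ext _ (fun e => ~ P e -> Q e)).
  by move=> e; split=> [[]//|PQ]; have [|/PQ] := pselect (P e); [left|right].
by apply: expressible_imp => //; apply: expressible_not.
Qed.

Lemma expressible_iff P Q :
  expressible P -> expressible Q -> expressible (fun e => P e <-> Q e).
Proof. by move=> hP hQ; apply: expressible_and; apply: expressible_imp. Qed.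

Lemma expressible_all (Q : HC -> (nat -> HC) -> Prop) :
  expressible (fun e => Q (e 0%N) (fun i => e i.+1)) ->
  expressible (fun e => forall x, Q x e).
Proof.
move=> hQ; apply: (@expressible_ext _ (fun e => ~ exists x, ~ Q x e)).
  move=> e; split=> [allQ [x]|nQ x]; first exact.
  by apply: contrapT => nQx; apply: nQ; exists x.
by apply: expressible_not; apply: expressible_ex; apply: expressible_not.
Qed.

Lemma expressible_pair i j k :
  expressible (fun e => hc_eq (e i) (hc_pair (e j) (e k))).
Proof.
have upair i' j' k' : expressible (fun e => hc_eq (e i') (hc_upair (e j') (e k'))).
  apply: (expressible_ext (fun e => hc_eq_upair _ _ _)).
  apply: expressible_all; apply: expressible_iff; first exact: expressible_mem.
  by apply: expressible_or; apply: expressible_eq.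
apply: (@expressible_ext _ (fun e => exists u v, hc_eq u (hc_upair (e j) (e j)) /\
   hc_eq v (hc_upair (e j) (e k)) /\ hc_eq (e i) (hc_upair u v))).
  move=> e; split=> [ijk|[u [v [eu [ev]]]]].
    by do 2 eexists; split; [exact: hc_eq_refl|split; [exact: hc_eq_refl|]].
  by move=> iuv; apply: hc_eq_trans iuv _; apply: hc_upair_congr.
do 2 apply: expressible_ex; do 2 (apply: expressible_and; first exact: upair).
exact: upair.
Qed.

Lemma expressible_pair_mem i j k :
  expressible (fun e => hc_mem (hc_pair (e i) (e j)) (e k)).
Proof.
apply: (@expressible_ext _
    (fun e => exists p, hc_eq p (hc_pair (e i) (e j)) /\ hc_mem p (e k))).
  move=> e; split=> [ijk|[p [pij pk]]]; first by eexists; split; [exact: hc_eq_refl|].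
  exact: hc_mem_congr pij (hc_eq_refl _) pk.
apply: expressible_ex; apply: expressible_and; first exact: expressible_pair.
exact: expressible_mem.
Qed.

Fixpoint rename (rho : nat -> nat) (phi : formula) : formula :=
  match phi with
  | Defs.Mem i j => Defs.Mem (rho i) (rho j)
  | Defs.Eq i j => Defs.Eq (rho i) (rho j)
  | Neg phi => Neg (rename rho phi)
  | And phi psi => And (rename rho phi) (rename rho psi)
  | Ex phi => Ex (rename (fun i => if i is j.+1 then (rho j).+1 else 0%N) phi)
  end.

(** Asking [e (rho i)] and [e' i] to be equal only as sets makes this include, for
    [rho] the identity, the invariance of satisfaction under [hc_eq]. *)
Lemma sat_rename phi rho e e' :
  (forall i, hc_eq (e (rho i)) (e' i)) -> sat e (rename rho phi) <-> sat e' phi.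
Proof.
elim: phi rho e e' => [i j|i j|phi IH|phi IHl psi IHr|phi IH] rho e e' ee' /=.
- by split; apply: hc_mem_congr => //; apply: hc_eq_sym.
- split=> [ij|ij].
  + exact: hc_eq_trans (hc_eq_sym (ee' i)) (hc_eq_trans ij (ee' j)).
  + exact: hc_eq_trans (ee' i) (hc_eq_trans ij (hc_eq_sym (ee' j))).
- by rewrite (IH rho e e').
- by rewrite (IHl rho e e') // (IHr rho e e').
- by split=> -[x sx]; exists x; move: sx;
    apply IH => -[|i] /=; do ?[exact: ee'|exact: hc_eq_refl].
Qed.

Lemma sat_param_congr phi x x' a a' : hc_eq x x' -> hc_eq a a' ->
  sat (env_cons x (fun=> a)) phi <-> sat (env_cons x' (fun=> a')) phi.
Proof.
move=> xx' aa'; have ren := @sat_rename phi id (env_cons x (fun=> a)).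
apply: iff_trans (iff_sym (ren (env_cons x (fun=> a)) _)) (ren _ _).
- by move=> i; apply: hc_eq_refl.
- by case.
Qed.

Lemma expressible_sat phi i j :
  expressible (fun e => sat (env_cons (e i) (fun=> e j)) phi).
Proof.
exists (rename (fun k => if k is _.+1 then j else i) phi) => e.
by apply: iff_sym; apply: sat_rename => -[|k]; apply: hc_eq_refl.
Qed.

(** * Definability of tuples of reals *)

(** With [omega] for [w], the set-theoretic definition of an injective function from
    a natural number to the power set of [omega].  As [w] is a variable, it can be
    supplied by the parameter of a formula. *)
Definition graph_of_inj_tuple (w z : HC) : Prop :=
  exists n, hc_mem n w /\
    (forall p, hc_mem p z -> exists i X,
       hc_mem i n /\ (forall m, hc_mem m X -> hc_mem m w) /\
       hc_eq p (hc_pair i X)) /\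
    (forall i, hc_mem i n -> exists X, hc_mem (hc_pair i X) z) /\
    (forall i X Y, hc_mem (hc_pair i X) z -> hc_mem (hc_pair i Y) z -> hc_eq X Y) /\
    (forall i j X, hc_mem (hc_pair i X) z -> hc_mem (hc_pair j X) z -> hc_eq i j).

Ltac express := repeat first
  [ apply: expressible_mem | apply: expressible_eq | apply: expressible_pair
  | apply: expressible_pair_mem | apply: expressible_sat
  | apply: expressible_and | apply: expressible_iff | apply: expressible_not
  | apply: expressible_ex | apply: expressible_imp | apply: expressible_all ].

(** A set of pairs as described is the code of the tuple whose i-th entry collects
    the [m] with [hc_nat m] in the value at [hc_nat i]; extensionality identifies the
    two. *)
Lemma graph_of_inj_tupleP (w z : HC) :
    (forall t, hc_mem t w <-> exists m, hc_eq t (hc_nat m)) ->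
  graph_of_inj_tuple w z <-> exists2 s, uniq s & hc_eq z (hc_tuple s).
Proof.
move=> wP; split=> [[n [nw [zP [nP [fun_z inj_z]]]]]|[s uniq_s zs]]; last first.
  have zE t := hc_mem_eq t zs.
  exists (hc_nat (size s)); split.
    by apply/wP; exists (size s); apply: hc_eq_refl.
  split; [|split; [|split]].
  - move=> p /zE/hc_mem_tuple[i ltis pE].
    exists (hc_nat i), (hc_real (nth set0 s i)); split.
      by apply/hc_mem_nat; exists i => //; apply: hc_eq_refl.
    by split=> // m /hc_mem_real[k _ mk]; apply/wP; exists k.
  - move=> i /hc_mem_nat[k ks ik]; exists (hc_real (nth set0 s k)).
    by apply/zE/hc_mem_pair_tuple; exists k => //; split=> //; apply: hc_eq_refl.
  - move=> i X Y /zE/hc_mem_pair_tuple[k _ [ik Xk]] /zE/hc_mem_pair_tuple[l _ [il Yl]].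
    have kl : k = l by apply: hc_nat_inj; apply: hc_eq_trans (hc_eq_sym ik) il.
    by rewrite kl in Xk; apply: hc_eq_trans Xk (hc_eq_sym Yl).
  - move=> i j X /zE/hc_mem_pair_tuple[k ks [ik Xk]].
    move=> /zE/hc_mem_pair_tuple[l ls [jl Xl]].
    have /eqP : nth set0 s k = nth set0 s l.
      by apply: hc_real_inj; apply: hc_eq_trans (hc_eq_sym Xk) Xl.
    rewrite nth_uniq // => /eqP kl; rewrite kl in ik.
    exact: hc_eq_trans ik (hc_eq_sym jl).
have [N nN] := (wP n).1 nw.
have nE t := hc_mem_eq t nN.
have /choice[X XP] (i : nat) :
    exists X, (i < N)%N -> hc_mem (hc_pair (hc_nat i) X) z.
  have [iN|_] := ltnP i N; last by exists n.
  have [|X Xz] := nP (hc_nat i); last by exists X.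
  by apply/nE/hc_mem_nat; exists i => //; apply: hc_eq_refl.
pose x i := [set m | hc_mem (hc_nat m) (X i)].
have xX i : (i < N)%N -> hc_eq (X i) (hc_real (x i)).
  move=> iN; have [j [Y [_ [Yw /hc_eq_pair[_ XY]]]]] := zP _ (XP i iN).
  apply: hc_ext => m; rewrite hc_mem_real; split=> [mX|[k kX mk]].
    have /wP[k mk] := Yw m ((hc_mem_eq m XY).1 mX).
    by exists k => //; apply: hc_mem_congr mX; last exact: hc_eq_refl.
  exact: hc_mem_congr (hc_eq_sym mk) (hc_eq_refl _) kX.
have xz i : (i < N)%N -> hc_mem (hc_pair (hc_nat i) (hc_real (x i))) z.
  move=> iN; apply: hc_mem_congr (XP i iN); last exact: hc_eq_refl.
  by apply/hc_eq_pair; split; [exact: hc_eq_refl|exact: xX].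
exists (mkseq x N).
  apply/(uniqP set0) => i j; rewrite !inE size_mkseq => iN jN.
  rewrite !nth_mkseq // => xij; apply: hc_nat_inj.
  by apply: inj_z (xz i iN) _; rewrite xij; apply: xz.
apply: hc_ext => p; rewrite hc_mem_tuple size_mkseq; split=> [pz|[i iN]].
  have [i [Y [/nE/hc_mem_nat[k kN ik] [_ pY]]]] := zP p pz.
  exists k => //; rewrite nth_mkseq //; apply: (hc_eq_trans pY).
  apply/hc_eq_pair; split=> //; apply: (fun_z (hc_nat k)); last exact: xz.
  apply: hc_mem_congr pz; last exact: hc_eq_refl.
  by apply: (hc_eq_trans pY); apply/hc_eq_pair; split=> //; apply: hc_eq_refl.
rewrite nth_mkseq // => pE.
by apply: hc_mem_congr (hc_eq_sym pE) (hc_eq_refl _) (xz i iN).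
Qed.

Lemma inj_finE (s : seq (set nat)) : inj_fin [set: set nat] s <-> uniq s.
Proof.
split=> [[n _ [t [ut _] <-]] //|us].
by exists (size s) => //; exists (in_tuple s).
Qed.

Definition guarded_head (A : set (seq (set nat))) (s : seq (set nat)) : set nat :=
  [set m | ~ A s /\ nth set0 s 0 m].

(** The first entry of s is the set X with <0, X> in s, so the pairs <s, r> of the
    graph are those where s is an injective tuple of reals and m belongs to r iff s
    is not in A and m belongs to some X with <0, X> in s. *)
Lemma definable_guarded_head (A : set (seq (set nat))) :
  definable_tuples A -> definable_fun (inj_fin [set: set nat]) (guarded_head A).
Proof.
move=> [phi [a phiP]].
(* The parameter [b] is the pair of the parameter for [A] and [omega]. *)
pose graph (x b : HC) := exists a' w s r,
  hc_eq b (hc_pair a' w) /\ hc_eq x (hc_pair s r) /\ graph_of_inj_tuple w s /\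
  (forall m, hc_mem m r <-> ~ sat (env_cons s (fun=> a')) phi /\
     exists o X, (forall t, ~ hc_mem t o) /\ hc_mem (hc_pair o X) s /\ hc_mem m X).
have [psi psiP] : expressible (fun e => graph (e 0%N) (e 1%N)).
  by rewrite /graph /graph_of_inj_tuple; express.
pose omega := hc_real setT.
have omegaP t : hc_mem t omega <-> exists m, hc_eq t (hc_nat m).
  by rewrite hc_mem_real; split=> [[m _]|[m]]; exists m.
have satA s s' a' : hc_eq s' (hc_tuple s) -> hc_eq a' a ->
    sat (env_cons s' (fun=> a')) phi <-> A s.
  move=> es ea; rewrite (sat_param_congr _ es ea) -phiP.
  split=> [[t At /hc_tuple_inj->]//|As]; exists s => //; exact: hc_eq_refl.
have headP s s' m : hc_eq s' (hc_tuple s) ->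
    (exists o X, (forall t, ~ hc_mem t o) /\ hc_mem (hc_pair o X) s' /\ hc_mem m X) <->
    exists2 k, nth set0 s 0 k & hc_eq m (hc_nat k).
  move=> es; split=> [[o [X [o0 [/(hc_mem_eq _ es)/hc_mem_pair_tuple[i _ [oi Xi]]]]]]|].
    have i0 : i = 0%N.
      case: i oi {Xi} => // i oi; case: (o0 (hc_nat 0)).
      by apply/(hc_mem_eq _ oi)/hc_mem_nat; exists 0%N => //; apply: hc_eq_refl.
    by move: Xi; rewrite i0 => Xi /(hc_mem_eq _ Xi)/hc_mem_real.
  move=> [k sk mk]; exists (hc_nat 0), (hc_real (nth set0 s 0)); split.
    by move=> t /hc_mem_nat[].
  split; last by apply/hc_mem_real; exists k.
  apply/(hc_mem_eq _ es)/hc_mem_pair_tuple; exists 0%N.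
    by rewrite lt0n; apply/eqP => /size0nil s0; move: sk; rewrite s0.
  by split; apply: hc_eq_refl.
exists psi, (hc_pair a omega) => x.
rewrite -(psiP (env_cons x (fun=> hc_pair a omega))) /=; split.
- move=> [s /inj_finE us xs].
  exists a, omega, (hc_tuple s), (hc_real (guarded_head A s)).
  split; first exact: hc_eq_refl.
  split=> //; split.
    by apply/(graph_of_inj_tupleP _ omegaP); exists s => //; apply: hc_eq_refl.
  move=> m; rewrite hc_mem_real (satA s) ?(headP s); try exact: hc_eq_refl.
  by split=> [[k [nAs sk] mk]|[nAs [k sk mk]]]; [split=> //|]; exists k.
- move=> [a' [w [s' [r [/hc_eq_pair[aa' ww'] [xsr [sw rP]]]]]]].
  have wP t : hc_mem t w <-> exists m, hc_eq t (hc_nat m).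
    by rewrite -(hc_mem_eq t ww').
  have /(graph_of_inj_tupleP _ wP)[s us ss] := sw.
  exists s; first exact/inj_finE.
  apply: hc_eq_trans xsr _; apply/hc_eq_pair; split=> //.
  apply: hc_ext => m; rewrite rP hc_mem_real (satA s) ?(headP s) //; last first.
    exact: hc_eq_sym.
  by split=> [[nAs [k sk mk]]|[k [nAs sk] mk]]; [|split=> //]; exists k.
Qed.

Lemma guarded_head_in (A : set (seq (set nat))) s : A s -> guarded_head A s = set0.
Proof. by move=> As; apply/seteqP; split=> // m []. Qed.

Lemma guarded_head_out (A : set (seq (set nat))) s :
  ~ A s -> guarded_head A s = nth set0 s 0.
Proof. by move=> nAs; apply/seteqP; split=> [m []|m]. Qed.

(** * From IP to HP *)

Lemma homogeneous_of_few_values (d : Order.disp_t) (K : orderType d)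
    (f : K -> set nat) (A : set (seq (set nat))) (S : set K) :
    regular_uncountable K -> (forall r, ~ stationary (f @^-1` [set r])) ->
    stationary S ->
    (forall n : nat,
       card_lt [set guarded_head A (tval t) | t in inj_pow (f @` S) n] [set: K]) ->
  exists2 S', stationary S' & inj_fin (f @` S') `\ [::] `<=` A.
Proof.
move=> hK fibres statS few; have [_ ncK _] := hK.
pose G n := [set guarded_head A (tval t) | t in inj_pow (f @` S) n].
exists (S `\` \bigcup_n f @^-1` G n).
  apply: stationary_setD_bigcup => // [|n _]; first exact: card_lt_countable.
  exact: (nonstationary_preimage hK fibres (few n)).
move=> s [[n _ [t [ut tS'] ts]] s_neq0]; apply: contrapT => nAs.
have n_gt0 : (0 < n)%N.
  rewrite -(size_tuple t) ts lt0n; apply/eqP => /size0nil s0.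
  exact: s_neq0.
have [y [_ yG] fy] := tS' (Ordinal n_gt0).
apply: yG; exists n => //; exists t.
  by split=> // i; have [z [Sz _] <-] := tS' i; exists z.
by rewrite ts guarded_head_out // fy (tnth_nth set0) ts.
Qed.

Lemma free_of_separated_values (d : Order.disp_t) (K : orderType d)
    (f : K -> set nat) (A : set (seq (set nat))) (k : nat) (S : 'I_k -> set K) :
    regular_uncountable K -> (forall r, ~ stationary (f @^-1` [set r])) ->
    (forall i, stationary (S i)) ->
    (forall x y : k.-tuple (set nat),
       inj_prod (fun i => f @` S i) x -> inj_prod (fun i => f @` S i) y ->
       (forall i, tnth x i <> tnth y i) -> guarded_head A x <> guarded_head A y) ->
  exists2 S' : 'I_k -> set K, forall i, stationary (S' i) &
    [set tval t | t in inj_prod (fun i => f @` S' i)] `&` A = set0.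
Proof.
move=> hK fibres statS sep; have [_ ncK _] := hK.
have [[x Sx Ax]|noA] :=
    pselect (exists2 x : k.-tuple _, inj_prod (fun i => f @` S i) x & A x); last first.
  exists S => //; apply/seteqP; split=> // _ [[t St <-] At].
  by apply: noA; exists t.
exists (fun i => S i `\` f @^-1` [set` tval x]) => [i|].
  apply: stationary_setD_preimage => //; apply: card_lt_countable => //.
  exact/finite_set_countable/finite_seq.
apply/seteqP; split=> // _ [[y [uy S'y] <-] Ay].
apply: (sep x y Sx); last by rewrite !guarded_head_in.
  by split=> // i; have [z [Sz _] <-] := S'y i; exists z.
move=> i xy; have [z [_ nxz] fz] := S'y i.
by apply: nxz; rewrite /= fz -xy mem_tnth.
Qed.

Theorem theorem2p9 (d : Order.disp_t) (K : orderType d)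
    (hK : regular_uncountable K) :
  IP [set: K] -> HP K.
Proof.
move=> IPK f A _ Adef.
have [[r stat_r]|nofibre] := pselect (exists r, stationary (f @^-1` [set r])).
  have [Ar|nAr] := pselect (A [:: r]); [left|right].
    (* An injective tuple all of whose entries are [r] has length at most 1. *)
    exists (f @^-1` [set r]) => // s [[n _ [t [ut tr] <-]] t_neq0].
    have allr : all (pred1 r) t.
      by apply/allP => _ /tnthP[i ->]; have [z <- <-] := tr i; apply/eqP.
    case: (tval t) ut allr t_neq0 => [_ _ []//|u [|v l]] /=.
      by move=> _ /andP[/eqP-> _].
    move=> /andP[uvl _] /and3P[/eqP ur /eqP vr _].
    by rewrite ur vr inE eqxx in uvl.
  exists 1%N, (fun=> f @^-1` [set r]); split=> //.
  apply/seteqP; split=> // _ [[t [_ tr] <-] At]; apply: nAr.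
  have [z zr] := tr ord0; rewrite (tnth_nth set0) [f z]zr => rt.
  by move: At (size_tuple t) rt; case: (tval t) => [|u []] //= At _ ->.
have fibres r : ~ stationary (f @^-1` [set r]).
  by move=> stat_r; apply: nofibre; exists r.
have := IPK f _ (definable_guarded_head Adef).
move=> [[S statS few]|[k [S [k0 statS sep]]]].
  by left; apply: homogeneous_of_few_values few.
have [S' statS' S'A] := free_of_separated_values hK fibres statS sep.
by right; exists k, S'.
Qed.
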